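(* Let $(M,\omega)$ be a closed connected symplectic manifold with a symplectic action of a compact connected Lie group $G=C\times T^r$, where the action is Hamiltonian on $C$ and totally non-Hamiltonian on the torus $T^r\cong(S^1)^r$, and let $\mu=(\mu_1,\mu_2):M\to\mathcal{C}^*\times(S^1)^r$ be a generalized moment map. Then there exists a matrix $Z\in\mathbb{Z}^{r\times r}$ with zero diagonal, defining an affine action $\mathrm{Aff}^Z$ of $T^r$ on $T^r\cong (S^1)^r$, such that $$\mu_2(t.x)=\mathrm{Aff}^Z(t)\,\mu_2(x)\qquad \text{for all } t\in T^r,\ x\in M.$$
   Context: For $Z\in\mathbb{Z}^{r\times r}$ the affine action $\mathrm{Aff}^Z$ of $T^r\cong(S^1)^r$ on $(S^1)^r$ is (writing the circle group multiplicatively) $$\mathrm{Aff}^Z(s_1,\dots,s_r)(t_1,\dots,t_r)=\Big(\prod_j s_j^{Z_{1j}}\,t_1,\dots,\prod_j s_j^{Z_{rj}}\,t_r\Big).$$ For $\xi$ in the Lie algebra $\mathcal{G}$ of $G$, $X_\xi$ is the fundamental vector field $X_\xi(x)=\frac{d}{dt}|_{t=0}\exp(-t\xi).x$. A symplectic action is Hamiltonian if the 1-form $i_{X_\xi}\omega$ is exact for every $\xi$ in the Lie algebra (no equivariance is required). Any compact connected Lie group $G$ acting symplectically on $(M,\omega)$ decomposes, after replacing $G$ by a covering if necessary, as $G=C\times T^r$, where $C$ is the maximal connected compact subgroup on which the action is Hamiltonian and $T^r$ is an $r$-dimensional torus acting in a totally non-Hamiltonian way, i.e. $i_{X_\eta}\omega$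 is non-exact for every nonzero $\eta$ in the Lie algebra $\mathcal{T}$ of $T^r$. $\mathcal{C}$ denotes the Lie algebra of $C$ and $\mathcal{C}^*$ its dual. Generalized moment map: let $\omega'$ be a $G$-invariant integral symplectic form on $M$ (its de Rham class lies in the image of $H^2(M,\mathbb{Z})$) such that for all $\xi\in\mathcal{G}$, $i_{X_\xi}\omega'$ is exact if and only if $i_{X_\xi}\omega$ is exact (such $\omega'$ exists). Fix a decomposition $T^r\cong (S^1)^r$ into circle factors, and let $\eta_j\in\mathcal{T}$ be a generator of the kernel of the exponential map of the $j$-th circle factor. A generalized moment map is a map $\mu=(\mu_1,\mu_2):M\to\mathcal{C}^*\times(S^1)^r$ where $\mu_1:M\to\mathcal{C}^*$ is smooth with $d\langle\mu_1,\xi\rangle=i_{X_\xi}\omega'$ for all $\xi\in\mathcal{C}$, and $\mu_2=(\mu_2^1,\dots,\mu_2^r)$ with $\mu_2^j:M\to S^1=\mathbb{R}/\mathbb{Z}$ smooth and $(\mu_2^j)^*(dt)=i_{X_{\eta_j}}\omega'$ (a McDuff moment map for the $j$-th circle factor), all relative to the same form $\omega'$. *)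

(* Defs.v *)
From HB Require Import structures.
From mathcomp Require Import all_boot all_order all_algebra.
From mathcomp Require Import ring_quotient.
From mathcomp Require Import all_classical all_reals all_analysis.

Set Implicit Arguments.
Unset Strict Implicit.
Unset Printing Implicit Defensive.

Import Order.TTheory GRing.Theory Num.Theory.
Import numFieldNormedType.Exports.

Local Open Scope classical_set_scope.
Local Open Scope ring_scope.

(** [C_on k U f]: [f] is of class C^k on [U], where [U] is meant to be open and [E]
  finite-dimensional. *)

Fixpoint C_on (R : realType) (E F : normedModType R) (k : nat) (U : set E)
    (f : E -> F) : Prop :=
  match k with
  | 0 => forall x, U x -> {for x, continuous f}
  | k'.+1 => (forall x, U x -> differentiable f x) /\
             forall v : E, C_on k' U (fun x => 'D_v f x)
  end.

Definition Cinf_on (R : realType) (E F : normedModType R) (U : set E)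
    (f : E -> F) : Prop :=
  forall k, C_on k U f.

(** A [chart] is a partial inverse pair between [source] and [target]; [fwd] and
  [bwd] are total functions whose values elsewhere are irrelevant.

  A [charted E] is a space with a set of charts in the model space [E] and a
  preferred chart [chart_at x] at every point [x].  It is raw data: the axioms of
  a smooth manifold are gathered in [is_manifold].  The tangent space at [x] is
  [E] itself, a tangent vector being identified with its coordinates in the
  chart [chart_at x]. *)

Record chart (R : realType) (E : normedModType R) (M : Type) := Chart {
  source : set M;
  target : set E;
  fwd : M -> E;
  bwd : E -> M
}.

Record charted (R : realType) (E : normedModType R) := Charted {
  pt :> topologicalType;
  atlas : set (chart E pt);
  chart_at : pt -> chart E pt
}.

Arguments atlas {R E} M : rename.
Arguments chart_at {R E M} x : rename.

Definition is_chart (R : realType) (E : normedModType R) (M : topologicalType)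
    (c : chart E M) : Prop :=
  [/\ open (source c) /\ open (target c),
      forall x, source c x -> target c (fwd c x) /\ bwd c (fwd c x) = x,
      forall y, target c y -> source c (bwd c y) /\ fwd c (bwd c y) = y,
      forall x, source c x -> {for x, continuous (fwd c)}
    & forall y, target c y -> {for y, continuous (bwd c)}].

Definition is_manifold (R : realType) (E : normedModType R) (M : charted E) :
    Prop :=
  [/\ hausdorff_space M /\ @second_countable M,
      forall c, atlas M c -> is_chart c,
      forall x : M, atlas M (chart_at x) /\ source (chart_at x) x
    & forall c d, atlas M c -> atlas M d ->
        Cinf_on (target c `&` bwd c @^-1` source d) (fwd d \o bwd c)].

Definition smooth_on (R : realType) (E F : normedModType R) (M : charted E)
    (N : charted F) (U : set M) (f : M -> N) : Prop :=
  (forall x, U x -> {for x, continuous f}) /\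
  forall c d, atlas M c -> atlas N d ->
    Cinf_on (target c `&` bwd c @^-1` (U `&` f @^-1` source d))
            (fwd d \o f \o bwd c).

Definition smooth (R : realType) (E F : normedModType R) (M : charted E)
    (N : charted F) (f : M -> N) : Prop :=
  smooth_on setT f.

Definition vec (R : realType) (E : normedModType R) : charted E :=
  let c := Chart setT setT (@id E) (@id E) in
  @Charted R E E [set c] (fun _ => c).

Definition line (R : realType) : charted R^o := vec R^o.

Definition prod_chart (R : realType) (E F : normedModType R) (M N : Type)
    (c : chart E M) (d : chart F N) : chart (E * F)%type (M * N)%type :=
  Chart (source c `*` source d) (target c `*` target d)
        (fun p => (fwd c p.1, fwd d p.2)) (fun q => (bwd c q.1, bwd d q.2)).

Definition prod_charted (R : realType) (E F : normedModType R) (M : charted E)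
    (N : charted F) : charted (E * F)%type :=
  @Charted R (E * F)%type (M * N)%type
    [set e | exists c d, [/\ atlas M c, atlas N d & e = prod_chart c d]]
    (fun p => prod_chart (chart_at p.1) (chart_at p.2)).

Definition pow_chart (R : realType) (M : Type) (r : nat)
    (c : 'I_r -> chart R^o M) : chart 'rV[R]_r 'rV[M]_r :=
  Chart [set x : 'rV[M]_r | forall i, source (c i) (x 0 i)]
        [set y : 'rV[R]_r | forall i, target (c i) (y 0 i)]
        (fun x => \row_i fwd (c i) (x 0 i))
        (fun y => \row_i bwd (c i) (y 0 i)).

Definition pow_charted (R : realType) (M : charted R^o) (r : nat) :
    charted 'rV[R]_r :=
  @Charted R 'rV[R]_r 'rV[M]_r
    [set e | exists2 c, forall i, atlas M (c i) & e = pow_chart c]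
    (fun x => pow_chart (fun i => chart_at (x 0 i))).

Definition tmap (R : realType) (E F : normedModType R) (M : charted E)
    (N : charted F) (f : M -> N) (x : M) : E -> F :=
  'd (fwd (chart_at (f x)) \o f \o bwd (chart_at x)) (fwd (chart_at x) x).

Definition velocity (R : realType) (E : normedModType R) (M : charted E)
    (gamma : line R -> M) (t : R) : E :=
  tmap gamma t (1 : R^o).

Definition oneform (R : realType) (E : normedModType R) (M : charted E) : Type :=
  M -> E -> R.

Definition twoform (R : realType) (E : normedModType R) (M : charted E) : Type :=
  M -> E -> E -> R.

Definition vfield (R : realType) (E : normedModType R) (M : charted E) : Type :=
  M -> E.

Definition differential (R : realType) (E : normedModType R) (M : charted E)
    (f : M -> line R) : oneform M :=
  fun x u => tmap f x u.

Definition exact_form (R : realType) (E : normedModType R) (M : charted E)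
    (alpha : oneform M) : Prop :=
  exists2 f : M -> line R,
    smooth f & forall x u, alpha x u = differential f x u.

Definition contract (R : realType) (E : normedModType R) (M : charted E)
    (X : vfield M) (w : twoform M) : oneform M :=
  fun x u => w x (X x) u.

Definition pullback (R : realType) (E F : normedModType R) (M : charted E)
    (N : charted F) (f : M -> N) (w : twoform N) : twoform M :=
  fun x u v => w (f x) (tmap f x u) (tmap f x v).

Definition in_chart (R : realType) (E : normedModType R) (M : charted E)
    (c : chart E M) (w : twoform M) : twoform (vec E) :=
  @pullback R E E (vec E) M (bwd c) w.

Definition is_twoform (R : realType) (E : normedModType R) (M : charted E)
    (w : twoform M) : Prop :=
  [/\ forall x u, linear (w x u : E -> R^o),
      forall x v, linear (w x ^~ v : E -> R^o),
      forall x u, w x u u = 0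
    & forall c, atlas M c -> forall u v,
        Cinf_on (target c) (fun y => in_chart c w y u v : R^o)].

(** [d w = 0]: in a chart, on constant vector fields [a1], [a2], [a3],
  [dw(a1,a2,a3) = D_a1 w(a2,a3) - D_a2 w(a1,a3) + D_a3 w(a1,a2)]. *)
Definition closed_form (R : realType) (E : normedModType R) (M : charted E)
    (w : twoform M) : Prop :=
  forall c, atlas M c -> forall y, target c y -> forall a1 a2 a3 : E,
    'D_a1 (fun z => in_chart c w z a2 a3 : R^o) y
    - 'D_a2 (fun z => in_chart c w z a1 a3 : R^o) y
    + 'D_a3 (fun z => in_chart c w z a1 a2 : R^o) y = 0.

Definition symplectic (R : realType) (E : normedModType R) (M : charted E)
    (w : twoform M) : Prop :=
  [/\ is_twoform w, closed_form w
    & forall x u, (forall v, w x u v = 0) -> u = 0].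

(** A simplex is a function on barycentric coordinates of which only the
  restriction to [std_simplex k] matters, see [is_cochain].  [H^*(M,Z)] and
  [H^*(M,R)] are computed by cochains on smooth simplices, and the de Rham
  isomorphism is integration over simplices. *)

Definition std_simplex (R : realType) (k : nat) : set 'rV[R]_k.+1 :=
  [set p | (forall i, 0 <= p 0 i) /\ \sum_i p 0 i = 1].

Arguments std_simplex R k : clear implicits.

Definition smooth_simplex (R : realType) (E : normedModType R) (M : charted E)
    (k : nat) (s : 'rV[R]_k.+1 -> M) : Prop :=
  exists (U : set 'rV[R]_k.+1) (s' : vec 'rV[R]_k.+1 -> M),
    [/\ open U, std_simplex R k `<=` U, @smooth_on R _ E (vec 'rV[R]_k.+1) M U s'
      & forall p, std_simplex R k p -> s' p = s p].

Definition face (R : realType) (k : nat) (i : 'I_k.+2) (p : 'rV[R]_k.+1) :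
    'rV[R]_k.+2 :=
  \row_j oapp (p 0) 0 (unlift i j).

Definition is_cochain (R : realType) (M A : Type) (k : nat)
    (z : ('rV[R]_k.+1 -> M) -> A) : Prop :=
  forall s s', (forall p, std_simplex R k p -> s p = s' p) -> z s = z s'.

Definition coboundary (R : realType) (M : Type) (A : pzRingType) (k : nat)
    (z : ('rV[R]_k.+1 -> M) -> A) (s : 'rV[R]_k.+2 -> M) : A :=
  \sum_(i < k.+2) (-1) ^+ i * z (s \o face i).

Definition barycentric2 (R : realType) (q : R^o * R^o) : 'rV[R]_3 :=
  \row_(i < 3) nth 0 [:: 1 - q.1 - q.2; q.1; q.2] i.

Definition simplex_integral (R : realType) (E : normedModType R) (M : charted E)
    (w : twoform M) (s : 'rV[R]_3 -> M) : R :=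
  Rintegral lebesgue_measure `[0, 1]%classic (fun a : R =>
    Rintegral lebesgue_measure `[0, 1 - a]%classic (fun b : R =>
      @pullback R _ E (vec (R^o * R^o)%type) M (s \o @barycentric2 R) w
        (a, b) (1, 0) (0, 1))).

(** The de Rham class of [w] is the image of the class of an integral cocycle
  [z]: the cocycles given by [w] and [z] differ by a real coboundary. *)
Definition integral_form (R : realType) (E : normedModType R) (M : charted E)
    (w : twoform M) : Prop :=
  exists (z : ('rV[R]_3 -> M) -> int) (b : ('rV[R]_2 -> M) -> R),
    [/\ is_cochain z, is_cochain b,
        forall s : 'rV[R]_4 -> M, smooth_simplex s -> coboundary z s = 0
      & forall s : 'rV[R]_3 -> M, smooth_simplex s ->
          simplex_integral w s = (z s)%:~R + coboundary b s].

Record lie_data (R : realType) (E : normedModType R) := LieData {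
  lpt :> charted E;
  lone : lpt;
  lmul : lpt -> lpt -> lpt;
  linv : lpt -> lpt
}.

Arguments lone {R E} G : rename.
Arguments lmul {R E G} : rename.
Arguments linv {R E G} : rename.

Definition is_lie_group (R : realType) (E : normedModType R) (G : lie_data E) :
    Prop :=
  [/\ is_manifold G,
      [/\ associative (@lmul _ _ G), left_id (lone G) (@lmul _ _ G)
        & left_inverse (lone G) (@linv _ _ G) (@lmul _ _ G)],
      smooth (fun p : prod_charted G G => lmul p.1 p.2)
    & smooth (@linv _ _ G)].

Definition prod_lie (R : realType) (E F : normedModType R) (G : lie_data E)
    (H : lie_data F) : lie_data (E * F)%type :=
  @LieData R (E * F)%type (prod_charted G H) (lone G, lone H)
    (fun p q => (lmul p.1 q.1, lmul p.2 q.2)) (fun p => (linv p.1, linv p.2)).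

(** [E] plays the role of the Lie algebra of [G], the tangent space at the unit. *)
Definition exp_rel (R : realType) (E : normedModType R) (G : lie_data E) (xi : E)
    (g : G) : Prop :=
  exists gamma : line R -> G,
    [/\ smooth gamma, forall s t : R, gamma (s + t) = lmul (gamma s) (gamma t),
        velocity gamma 0 = xi & gamma 1 = g].

Definition lexp (R : realType) (E : normedModType R) (G : lie_data E) (xi : E) :
    G :=
  xget (lone G) (exp_rel xi).

Arguments lexp {R E} G xi.

(** The circle is [R/Z], written additively, with the quotient topology. *)
Definition integers (R : realType) : R -> bool := fun a => a \is a Num.int.

Lemma integers_closed (R : realType) : zmod_closed (@integers R).
Proof.
by split=> [|a b ha hb]; rewrite unfold_in; [exact: rpred0|exact: rpredB].
Qed.

HB.instance Definition _ (R : realType) :=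
  GRing.isZmodClosed.Build (R : zmodType) (@integers R) (@integers_closed R).

Definition circle (R : realType) : Type :=
  Quotient.quot (GRing.ZmodClosed.clone R (@integers R) _).

HB.instance Definition _ (R : realType) := GRing.Zmodule.on (circle R).

Definition circle_pi (R : realType) : R -> circle R :=
  \pi_(Quotient.quot (GRing.ZmodClosed.clone R (@integers R) _))%qT.

Definition circle_open (R : realType) : set_system (circle R) :=
  [set U | open (@circle_pi R @^-1` U)].

Lemma circle_openT (R : realType) : circle_open [set: circle R].
Proof. by rewrite /circle_open /= preimage_setT; exact: openT. Qed.

Lemma circle_openI (R : realType) (U V : set (circle R)) :
  circle_open U -> circle_open V -> circle_open (U `&` V).
Proof. exact: openI. Qed.

Lemma circle_open_bigU (R : realType) (I : Type) (U : I -> set (circle R)) :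
  (forall i, circle_open (U i)) -> circle_open (\bigcup_i U i).
Proof. by move=> oU; apply: bigcup_open => i _; exact: oU. Qed.

HB.instance Definition _ (R : realType) :=
  isOpenTopological.Build (circle R) (@circle_openT R) (@circle_openI R)
    (@circle_open_bigU R).

(** The inverses of the quotient map on the intervals [(a - 1/2, a + 1/2)]. *)
Definition circle_chart (R : realType) (a : R) : chart R^o (circle R) :=
  let I := [set y : R^o | a - 2^-1 < y < a + 2^-1] in
  Chart (@circle_pi R @` I) I
        (fun s => xget (a : R^o) [set y | I y /\ circle_pi y = s])
        (@circle_pi R).

Definition circle_charted (R : realType) : charted R^o :=
  @Charted R R^o (circle R) (range (@circle_chart R))
    (fun s => circle_chart (repr s)).

Definition circle_lie (R : realType) : lie_data R^o :=
  @LieData R R^o (circle_charted R) 0 +%R -%R.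

Definition torus_lie (R : realType) (r : nat) : lie_data 'rV[R]_r :=
  @LieData R 'rV[R]_r (pow_charted (circle_charted R) r)
    (0 : 'rV[circle R]_r) +%R -%R.

Definition Aff (R : realType) (r : nat) (Z : 'M[int]_r) (s t : 'rV[circle R]_r) :
    'rV[circle R]_r :=
  \row_i (\sum_j s 0 j *~ Z i j + t 0 i).

(** The form [dt]: the preferred charts of the circle are local inverses of the
  quotient map [R -> R/Z]. *)
Definition circle_dt (R : realType) : oneform (circle_charted R) := fun _ v => v.

Definition circle_factor (R : realType) (r : nat) (j : 'I_r)
    (s : circle_lie R) : torus_lie R r :=
  \row_i (if i == j then s : circle R else 0).

(** [eta] is a generator of the kernel of the exponential map of the [j]-th
  circle factor. *)
Definition circle_generator (R : realType) (r : nat) (j : 'I_r)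
    (eta : 'rV[R]_r) : Prop :=
  exists2 u : R^o,
    forall v : R^o, lexp (circle_lie R) v = lone (circle_lie R) <->
                    exists z : int, v = u *~ z
    & eta = tmap (@circle_factor R r j) (lone (circle_lie R)) u.

Section Actions.
Variables (R : realType) (E F : normedModType R) (G : lie_data F).
Variables (M : charted E) (act : G -> M -> M).

Definition is_smooth_action : Prop :=
  [/\ forall x, act (lone G) x = x,
      forall g h x, act (lmul g h) x = act g (act h x)
    & smooth (fun p : prod_charted G M => act p.1 p.2)].

Definition invariant_form (w : twoform M) : Prop :=
  forall g x u v, pullback (act g) w x u v = w x u v.

Definition fundamental (xi : F) : vfield M :=
  fun x => velocity (fun t : line R => act (lexp G (- (t : R) *: xi)) x) 0.

Definition hamiltonian (w : twoform M) : Prop :=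
  forall xi, exact_form (contract (fundamental xi) w).

Definition totally_nonhamiltonian (w : twoform M) : Prop :=
  forall eta, eta != 0 -> ~ exact_form (contract (fundamental eta) w).

End Actions.

Section MomentMaps.
Variables (R : realType) (m r : nat) (E : normedModType R) (M : charted E).
Variables (C : lie_data 'rV[R]_m) (act : prod_lie C (torus_lie R r) -> M -> M).

Definition act_l (c : C) (x : M) : M := act (c, lone (torus_lie R r)) x.

Definition act_r (t : torus_lie R r) (x : M) : M := act (lone C, t) x.

(** The dual of the Lie algebra ['rV_m] of [C] is ['cV_m]. *)
Definition is_moment_map (w : twoform M) (mu1 : M -> 'cV[R]_m) : Prop :=
  @smooth R _ _ M (vec 'cV[R]_m) mu1 /\
  forall (xi : 'rV[R]_m) x u,
    differential (fun y => (xi *m mu1 y) 0 0 : line R) x u =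
    contract (fundamental act_l xi) w x u.

Definition is_mcduff_map (w : twoform M) (eta : 'rV[R]_r)
    (f : M -> circle_charted R) : Prop :=
  smooth f /\
  forall x u, circle_dt (f x) (tmap f x u) =
              contract (fundamental act_r eta) w x u.

Definition generalized_moment_map (w : twoform M) (mu1 : M -> 'cV[R]_m)
    (mu2 : M -> 'rV[circle R]_r) : Prop :=
  exists (w' : twoform M) (eta : 'I_r -> 'rV[R]_r),
    [/\ [/\ symplectic w', invariant_form act w' & integral_form w'],
        forall xi, exact_form (contract (fundamental act xi) w') <->
                   exact_form (contract (fundamental act xi) w),
        forall j, circle_generator j (eta j),
        is_moment_map w' mu1
      & forall j, is_mcduff_map w' (eta j) (fun x => mu2 x 0 j)].

End MomentMaps.

(* Main.v *)
Require Import Defs.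
From HB Require Import structures.
From mathcomp Require Import all_boot all_order all_algebra.
From mathcomp Require Import zify lra.
From mathcomp Require Import all_classical all_reals all_analysis.

Set Implicit Arguments.
Unset Strict Implicit.
Unset Printing Implicit Defensive.

Import Order.TTheory GRing.Theory Num.Theory.
Import numFieldNormedType.Exports.

Local Open Scope classical_set_scope.
Local Open Scope ring_scope.

(** Write [f] for the [i]-th component of [mu2] and [X] for the fundamental
  field of [eta i], so that [df = w'(X, .)].

  The torus is abelian, so each [act_r s] maps [X] to itself, and it preserves
  [w'].  Hence [f] and [f \o act_r s] have the same differential.  Two maps to
  the circle with the same differential on a connected manifold differ by a
  constant ([circle_diff_cst]), so [f (s.x) - f x = c s] with [c s] independent
  of [x] ([mcduff_act_r_cst]).  It follows at once that [c] is a homomorphism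
  from the torus to the circle, and it remains to see that [c] is given by
  integers.

  Along a one-parameter subgroup [t |-> torus_exp (t v)] the homomorphism [c] is
  differentiable at the origin, with derivative
  [a = w'(X, d/dt (exp(tv).x))].  A homomorphism from the line to the circle
  which is differentiable at the origin is [t |-> a t mod 1]
  ([circle_affine_line]), whence [mcduff_orbit_line].  For [v] the [j]-th basis
  vector the subgroup closes up at [t = 1], so that [a] is an integer: this is
  the entry [Z i j].  For [j = i] the derivative is a multiple of
  [w'(X, X) = 0], so the diagonal vanishes.

  To apply this, the exponential map of the torus, which enters through the
  definition of [X], has to be identified with the componentwise projection
  [R^r -> (R/Z)^r] ([lexp_torus]).  The one-parameter subgroups of the circle
  are again given by [circle_affine_line].

  Differentials are handled by the predicate [is_tmap f x L]: the expression of
  [f] in the preferred charts at [x] and [f x] has differential [L].  It obeys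
  the chain rule ([is_tmap_comp]) with no change of charts, and it only asks for
  differentiability at one point. *)

(** * Differentials of maps between normed spaces *)

Lemma near_eq_is_diff (R : realType) (V W : normedModType R) (f g df : V -> W)
    (x : V) :
  (\forall y \near x, f y = g y) -> is_diff x f df -> is_diff x g df.
Proof.
move=> fg [fx fdf]; have fgx : f x = g x by exact: nbhs_singleton fg.
have [cf ef] : continuous ('d f x) /\
    g \o shift x = cst (g x) + 'd f x +o_ 0 id.
  have [cf ef] := (diff_locallyP _ _).1 fx; split => //.
  apply/eqaddoP => e e0; have /eqaddoP/(_ e e0) := ef.
  apply: filterS2; last by rewrite (near_shift 0 x) in fg; exact: fg.
  by move=> y /=; rewrite subr0 !fctE fgx => <-.
have dg : 'd g x = 'd f x :> (V -> W) by exact: diff_unique.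
by apply: DiffDef; [apply/diff_locallyP; rewrite dg|rewrite dg].
Qed.

Lemma is_diff_entry (R : realType) (V : normedModType R) (r : nat)
    (f df : V -> 'rV[R]_r) (x : V) (i : 'I_r) :
  is_diff x f df ->
  is_diff x (fun y => f y 0 i : R^o) (fun v => df v 0 i : R^o).
Proof.
move=> [fx <-].
pose c (N : 'rV[R]_r) : R^o := N 0 i.
have lc : linear c by move=> a u v; rewrite /c !mxE.
pose cM := GRing.isLinear.Build _ _ _ _ c lc.
pose cL : {linear 'rV[R]_r -> R^o} := HB.pack c cM.
have cc : continuous c by exact: coord_continuous.
have dc : differentiable c (f x) by exact: (@linear_differentiable _ _ _ cL).
apply: DiffDef; first exact: (differentiable_comp fx dc).
rewrite (diff_comp fx dc) (_ : 'd c (f x) = c :> (_ -> _)) //.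
exact: (@diff_lin _ _ _ cL).
Qed.

Lemma is_diff_row (R : realType) (V : normedModType R) (r : nat)
    (f df : 'I_r -> V -> R^o) (x : V) :
  (forall i, is_diff x (f i) (df i)) ->
  is_diff x (fun y => \row_i f i y : 'rV[R]_r) (fun v => \row_i df i v).
Proof.
move=> fx; pose F (y : V) : 'rV[R]_r := \row_i f i y.
have FE : F = \sum_i (fun y => f i y *: (delta_mx 0 i : 'rV[R]_r)).
  apply/funext => y; apply/rowP => j; rewrite fct_sumE summxE mxE.
  rewrite (bigD1 j) //= big1 => [|i ij].
    by rewrite !mxE !eqxx mulr1 addr0.
  by rewrite !mxE eqxx eq_sym (negbTE ij) mulr0.
have dF : differentiable F x.
  rewrite FE; apply: differentiable_sum => i.
  by apply: differentiableZl; have [] := fx i.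
apply: DiffDef => //; apply/funext => v; apply/rowP => i.
have [_ /(congr1 (fun h => h v)) /= <-] := is_diff_entry i (differentiableP dF).
have -> : (fun y => F y 0 i : R^o) = f i by apply/funext => y; rewrite mxE.
by rewrite mxE diff_val.
Qed.

Lemma is_diff_fun_eq (R : realType) (V W : normedModType R) (f df dg : V -> W)
    (x : V) : is_diff x f df -> df =1 dg -> is_diff x f dg.
Proof. by move=> fx /funext <-. Qed.

(** * Differentials in preferred charts *)

(** The local conditions on the preferred chart at [x] under which maps can be
  read in it.  They involve one chart only, so they hold for the circle, the
  torus and products without any check of smooth compatibility of charts. *)
Definition adapted (R : realType) (E : normedModType R) (M : charted E)
    (x : M) : Prop :=
  let c := chart_at x in
  [/\ atlas M c /\ nbhs x (source c), nbhs (fwd c x) (target c),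
      forall y, source c y -> bwd c (fwd c y) = y,
      forall z, target c z -> fwd c (bwd c z) = z
    & {for fwd c x, continuous (bwd c)}].

(** Continuity is part of the definition because the chart expression of [f]
  says nothing about points sent outside the source of the chart at [f x]. *)
Definition is_tmap (R : realType) (E F : normedModType R) (M : charted E)
    (N : charted F) (f : M -> N) (x : M) (L : E -> F) : Prop :=
  {for x, continuous f} /\
  is_diff (fwd (chart_at x) x) (fwd (chart_at (f x)) \o f \o bwd (chart_at x)) L.

Section TangentMaps.
Variable R : realType.

Lemma tmapE (E F : normedModType R) (M : charted E) (N : charted F)
    (f : M -> N) (x : M) (L : E -> F) : is_tmap f x L -> tmap f x = L.
Proof. by case=> _ [_ ?]. Qed.

Lemma is_tmap_eq (E F : normedModType R) (M : charted E) (N : charted F)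
    (f : M -> N) (x : M) (L L' : E -> F) :
  is_tmap f x L -> L =1 L' -> is_tmap f x L'.
Proof. by move=> fx /funext <-. Qed.

Lemma adapted_bwdK (E : normedModType R) (M : charted E) (x : M) :
  adapted x -> bwd (chart_at x) (fwd (chart_at x) x) = x.
Proof. by case=> [[_ sx]] _ h _ _; apply: h; exact: nbhs_singleton sx. Qed.

Lemma manifold_adapted (E : normedModType R) (M : charted E) (x : M) :
  is_manifold M -> adapted x.
Proof.
case=> _ ch at_ _; have [ax sx] := at_ x.
have [[os ot] hs ht _ cb] := ch _ ax.
split=> //.
- by split=> //; exact: open_nbhs_nbhs.
- by apply: open_nbhs_nbhs; split => //; have [] := hs _ sx.
- by move=> y /hs[].
- by move=> y /ht[].
- by apply: cb; have [] := hs _ sx.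
Qed.

Lemma vec_adapted (E : normedModType R) (x : vec E) : adapted x.
Proof. by split=> //=; [split=> //|]; exact: filterT. Qed.

Lemma prod_adapted (E F : normedModType R) (M : charted E) (N : charted F)
    (x : M) (y : N) :
  adapted x -> adapted y -> @adapted _ _ (prod_charted M N) (x, y).
Proof.
move=> [[ax sx] tx fx gx cx] [[ay sy] ty fy gy cy]; split=> /=.
- split; first by exists (chart_at x), (chart_at y).
  by exists (source (chart_at x), source (chart_at y)).
- by exists (target (chart_at x), target (chart_at y)).
- by move=> -[u v] /= [/fx -> /fy ->].
- by move=> -[u v] /= [/gx -> /gy ->].
- apply: cvg_pair; apply: cvg_comp.
  + exact: cvg_fst.
  + exact: cx.
  + exact: cvg_snd.
  + exact: cy.
Qed.

Lemma continuous_row (T : topologicalType) (S : topologicalType) (r : nat)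
    (f : T -> 'rV[S]_r) (x : T) :
  (forall i, {for x, continuous (fun y => f y 0 i)}) -> {for x, continuous f}.
Proof.
move=> fc A [P fP PA]; apply: (filterS PA).
suff : \forall y \near x, forall i, P 0 i (f y 0 i).
  by apply: filterS => y h i j; rewrite ord1; exact: h.
by apply: filter_forall => i; apply: fc; exact: fP.
Qed.

Lemma continuous_entry (S : topologicalType) (r : nat) (i : 'I_r)
    (x : 'rV[S]_r) : {for x, continuous (fun y : 'rV[S]_r => y 0 i)}.
Proof.
move=> A xA; exists (fun _ j => if j == i then A else setT).
  move=> k j; rewrite ord1; case: eqP => [->|_] //; exact: filterT.
by move=> y /(_ 0 i); rewrite eqxx.
Qed.

Lemma pow_adapted (N : charted R^o) (r : nat) (x : pow_charted N r) :
  (forall i, adapted (x 0 i)) -> adapted x.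
Proof.
move=> h; split=> /=.
- split; first by exists (fun i => chart_at (x 0 i)) => // i; have [[]] := h i.
  exists (fun _ i => source (chart_at (x 0 i))).
    by move=> k i; rewrite ord1; have [[]] := h i.
  by move=> y hy i; exact: hy.
- exists (fun _ i => target (chart_at (x 0 i))).
    by move=> k i; rewrite ord1 mxE; have [] := h i.
  by move=> y hy i; exact: hy.
- move=> y hy; apply/rowP => i; rewrite !mxE.
  by have [_ _ k _ _] := h i; exact: k.
- move=> y hy; apply/rowP => i; rewrite !mxE.
  by have [_ _ _ k _] := h i; exact: k.
- apply: continuous_row => i.
  rewrite (_ : (fun y => _) =
      bwd (chart_at (x 0 i)) \o (fun y : 'rV[R]_r => y 0 i)); last first.
    by apply/funext => y; rewrite mxE.
  apply: continuous_comp; first exact: continuous_entry.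
  by rewrite mxE; have [] := h i.
Qed.

Lemma smooth_is_tmap (E F : normedModType R) (M : charted E) (N : charted F)
    (f : M -> N) (x : M) :
  smooth f -> adapted x -> adapted (f x) -> is_tmap f x (tmap f x).
Proof.
move=> [fc fs] ax afx; split; first exact: fc.
have [[cx sx] tx _ _ _] := ax; have [[cfx sfx] _ _ _ _] := afx.
apply: differentiableP; have [+ _] := fs _ _ cx cfx 1%N; apply; split.
  exact: nbhs_singleton tx.
by rewrite /= adapted_bwdK //; split => //; exact: nbhs_singleton sfx.
Qed.

(** Continuity of [f] read in the chart at [x]: this is what makes chart
  expressions of composites agree near the point. *)
Lemma adapted_near (E : normedModType R) (M : charted E) (T : topologicalType)
    (f : M -> T) (x : M) (S : set T) :
  adapted x -> {for x, continuous f} -> nbhs (f x) S ->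
  \forall z \near fwd (chart_at x) x, S (f (bwd (chart_at x) z)).
Proof.
move=> ax fc fS; have [_ _ _ _ bc] := ax.
have := @continuous_comp _ _ _ (bwd (chart_at x)) f (fwd (chart_at x) x) bc.
by rewrite adapted_bwdK // => /(_ fc); apply; rewrite /= adapted_bwdK.
Qed.

(** The chain rule: the preferred chart at [f x] cancels in the composite of the
  two chart expressions, near the point. *)
Lemma is_tmap_comp (E F H : normedModType R) (M : charted E) (N : charted F)
    (P : charted H) (f : M -> N) (g : N -> P) (x : M) (L : E -> F)
    (L' : F -> H) :
  adapted x -> adapted (f x) -> is_tmap f x L -> is_tmap g (f x) L' ->
  is_tmap (g \o f) x (L' \o L).
Proof.
move=> ax afx [fc fd] [gc gd]; split; first exact: continuous_comp.
have [[_ sfx] _ k _ _] := afx.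
apply: (@near_eq_is_diff _ _ _
  ((fwd (chart_at (g (f x))) \o g \o bwd (chart_at (f x))) \o
   (fwd (chart_at (f x)) \o f \o bwd (chart_at x)))).
  by have := adapted_near ax fc sfx; apply: filterS => z /k /= ->.
by apply: is_diff_comp; rewrite /= adapted_bwdK.
Qed.

Lemma is_tmap_pair (E F H : normedModType R) (M : charted E) (N : charted F)
    (P : charted H) (f : M -> N) (g : M -> P) (x : M) (L : E -> F)
    (L' : E -> H) :
  is_tmap f x L -> is_tmap g x L' ->
  @is_tmap R _ _ M (prod_charted N P) (fun y => (f y, g y)) x
    (fun v => (L v, L' v)).
Proof.
move=> [fc fd] [gc gd]; split; first exact: cvg_pair.
exact: is_diff_pair.
Qed.

Lemma is_tmap_cst (E F : normedModType R) (M : charted E) (N : charted F)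
    (a : N) (x : M) : is_tmap (fun _ : M => a) x (fun=> 0).
Proof. by split; [exact: cvg_cst|exact: is_diff_cst]. Qed.

Lemma is_tmap_id (E : normedModType R) (M : charted E) (x : M) :
  adapted x -> is_tmap (fun y : M => y) x id.
Proof.
move=> [_ tx _ k _]; split; first exact: cvg_id.
apply: (@near_eq_is_diff _ _ _ id).
by apply: filterS tx => z /k /= ->.
Qed.

Lemma is_tmap_vec (E F : normedModType R) (f L : E -> F) (x : E) :
  is_diff x f L -> @is_tmap R E F (vec E) (vec F) f x L.
Proof.
by move=> fL; split => //; apply: differentiable_continuous; exact: ex_diff.
Qed.

Lemma is_tmap_row (E : normedModType R) (M : charted E) (N : charted R^o)
    (r : nat) (f : M -> pow_charted N r) (x : M) (L : 'I_r -> E -> R^o) :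
  (forall i, is_tmap (fun y => f y 0 i : N) x (L i)) ->
  is_tmap f x (fun v => \row_i L i v).
Proof.
move=> h; split; first by apply: continuous_row => i; have [] := h i.
exact: (is_diff_row (fun i => (h i).2)).
Qed.

Lemma is_tmap_entry (E : normedModType R) (M : charted E) (N : charted R^o)
    (r : nat) (f : M -> pow_charted N r) (x : M) (L : E -> 'rV[R]_r) (i : 'I_r) :
  is_tmap f x L -> is_tmap (fun y => f y 0 i : N) x (fun v => L v 0 i).
Proof.
move=> [fc fd]; split.
  exact: (continuous_comp fc (@continuous_entry _ _ i (f x))).
have := is_diff_entry i fd; apply: near_eq_is_diff.
by apply: nearW => z /=; rewrite mxE.
Qed.

End TangentMaps.

(** * The circle *)

Section Circle.
Variable R : realType.

Local Notation integers_zmod := (GRing.ZmodClosed.clone R (@integers R) _).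

Lemma circle_piD (x y : R) :
  circle_pi (x + y) = circle_pi x + circle_pi y.
Proof. exact: (@pi_addr _ _ _ _ _ (Quotient.quot integers_zmod)). Qed.

Lemma circle_piN (x : R) : circle_pi (- x) = - circle_pi x.
Proof. exact: (@pi_oppr _ _ _ _ _ (Quotient.quot integers_zmod)). Qed.

Lemma circle_piB (x y : R) : circle_pi (x - y) = circle_pi x - circle_pi y.
Proof. by rewrite circle_piD circle_piN. Qed.

Lemma circle_pi0 : circle_pi (0 : R) = 0.
Proof. exact: (@pi_zeror _ _ _ _ _ (Quotient.quot integers_zmod)). Qed.

Lemma circle_piMn (x : R) n : circle_pi (x *+ n) = circle_pi x *+ n.
Proof.
by elim: n => [|n IH]; rewrite ?mulr0n ?circle_pi0 // !mulrS circle_piD IH.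
Qed.

Lemma circle_piMz (x : R) (z : int) : circle_pi (x *~ z) = circle_pi x *~ z.
Proof.
case: z => n; first by rewrite -!pmulrn circle_piMn.
by rewrite NegzE !mulrNz -!pmulrn circle_piN circle_piMn.
Qed.

Lemma circle_pi_repr (s : circle R) : circle_pi (repr s : R) = s.
Proof. exact: reprK. Qed.

Lemma circle_pi_eq (x y : R) :
  circle_pi x = circle_pi y -> exists z : int, x - y = z%:~R.
Proof.
move=> /eqP h; apply/intrP.
have E := Quotient.idealrBE integers_zmod x y.
by have : x - y \in @integers R := etrans E h.
Qed.

Lemma circle_pi_int (z : int) : circle_pi (z%:~R : R) = 0.
Proof.
have E := Quotient.idealrBE integers_zmod z%:~R 0.
rewrite -circle_pi0; apply/eqP; apply: (etrans (esym E)).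
by rewrite subr0; apply/intrP; exists z.
Qed.

Lemma circle_pi_inj_near (x y : R) :
  `|x - y| < 1 -> circle_pi x = circle_pi y -> x = y.
Proof.
move=> xy /circle_pi_eq[z e]; move: xy; rewrite e -intr_norm ltrz1 => z1.
by apply/eqP; rewrite -subr_eq0 e intr_eq0 -normr_eq0; lia.
Qed.

(** The form in which separation of the circle is used: two nonzero
  representatives of [s], both smaller than [1/2] in absolute value, coincide,
  so they cannot be arbitrarily small. *)
Lemma circle_small_eq0 (s : circle R) :
  (forall e : R, 0 < e -> exists2 d, `|d| < e & circle_pi d = s) -> s = 0.
Proof.
move=> h; have [d d1 ds] := h 2^-1 ltac:(by rewrite invr_gt0).
have [d0|d0] := eqVneq d 0; first by rewrite -ds d0 circle_pi0.
have [b bd bs] := h `|d| ltac:(by rewrite normr_gt0).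
suff db : d = b by rewrite -db ltxx in bd.
apply: circle_pi_inj_near; last by rewrite ds.
apply: le_lt_trans (ler_normB _ _) _; lra.
Qed.

Lemma circle_pi_continuous : continuous (@circle_pi R : R^o -> circle R).
Proof. by apply/continuousP => U oU; exact: oU. Qed.

Lemma circle_chart_fwd (a y : R) : a - 2^-1 < y < a + 2^-1 ->
  fwd (circle_chart a) (circle_pi y) = y.
Proof.
move=> ay; apply: xget_unique => // z [/= az zy].
by apply: circle_pi_inj_near zy; rewrite ltr_norml; lra.
Qed.

Lemma open_circle_chart_target (a : R) : open (target (circle_chart a)).
Proof.
rewrite (_ : target _ = `]a - 2^-1, a + 2^-1[%classic); first exact: itv_open.
by apply/seteqP; split => y /=; rewrite in_itv.
Qed.

Lemma open_circle_chart_source (a : R) : open (source (circle_chart a)).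
Proof.
suff : open (@circle_pi R @^-1` source (circle_chart a)) by [].
rewrite (_ : _ @^-1` _ = \bigcup_(z : int)
    ((fun y : R^o => y + z%:~R) @^-1` target (circle_chart a))); last first.
  apply/seteqP; split => y /=.
    move=> [b /= ab /circle_pi_eq[z e]]; exists z => //=.
    by rewrite -e subrKC.
  move=> [z _ /= h]; exists (y + z%:~R) => //.
  by rewrite circle_piD circle_pi_int addr0.
apply: bigcup_open => z _; apply: open_comp; last exact: open_circle_chart_target.
by move=> y _; apply: continuousD; [exact: cvg_id|exact: cvg_cst].
Qed.

Lemma circle_adapted (s : circle_charted R) : adapted s.
Proof.
have rs : target (circle_chart (repr s)) (repr s).
  by rewrite /= ltrDl ltrBlDr ltrDl invr_gt0 ltr0n.
have ft : fwd (circle_chart (repr s)) s = repr s.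
  by rewrite -{2}(circle_pi_repr s) circle_chart_fwd.
split=> /=.
- split; first by exists (repr s).
  apply: open_nbhs_nbhs; split; first exact: open_circle_chart_source.
  by exists (repr s) => //; exact: circle_pi_repr.
- rewrite [X in nbhs X]ft; apply: open_nbhs_nbhs.
  by split; first exact: open_circle_chart_target.
- move=> _ [y ay <-].
  by rewrite [X in circle_pi X](circle_chart_fwd ay).
- by move=> z az; exact: circle_chart_fwd.
- exact: circle_pi_continuous.
Qed.

(** Near [x], a chart composed with the quotient map is a translation by an
  integer: this is the source of all smoothness and derivatives on the circle. *)
Lemma circle_chart_near (a x : R) : source (circle_chart a) (circle_pi x) ->
  \forall y \near (x : R^o), fwd (circle_chart a) (circle_pi y) =
     y + (fwd (circle_chart a) (circle_pi x) - x).
Proof.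
move=> [b ab bx]; rewrite -bx circle_chart_fwd //.
have [z e] := circle_pi_eq bx.
have : \forall y \near (x : R^o), target (circle_chart a) (y + (b - x)).
  have c : {for x : R^o, continuous (fun y : R^o => y + (b - x))}.
    by apply: continuousD; [exact: cvg_id|exact: cvg_cst].
  apply: c; rewrite subrKC; apply: open_nbhs_nbhs.
  by split => //; exact: open_circle_chart_target.
apply: filterS => y ay.
by rewrite -(circle_chart_fwd ay) circle_piD e circle_pi_int addr0.
Qed.

Lemma is_tmap_circle_pi (x : line R) :
  @is_tmap R _ _ (line R) (circle_charted R) (@circle_pi R) x id.
Proof.
split; first exact: circle_pi_continuous.
have s : source (circle_chart (repr (circle_pi x))) (circle_pi x).
  by have [[_ /nbhs_singleton]] := circle_adapted (circle_pi x).
apply: (@near_eq_is_diff _ _ _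
  (id + cst (fwd (circle_chart (repr (circle_pi x))) (circle_pi x) - x))).
  by have := circle_chart_near s; apply: filterS => y /= ->.
by rewrite -[X in is_diff_def _ _ X]addr0; exact: is_diffD.
Qed.

(** A differentiable map to the circle lifts locally to the line, through the
  chart at the image point. *)
Lemma is_tmap_lift (E : normedModType R) (M : charted E)
    (f : M -> circle_charted R) (x : M) (L : E -> R^o) :
  adapted x -> is_tmap f x L ->
  exists2 phi : E -> R^o, is_diff (fwd (chart_at x) x) phi L &
    \forall z \near fwd (chart_at x) x,
      circle_pi (phi z) = f (bwd (chart_at x) z).
Proof.
move=> ax [fc fd]; exists (fwd (chart_at (f x)) \o f \o bwd (chart_at x)) => //.
have [[_ sfx] _ k _ _] := circle_adapted (f x).
by have := adapted_near ax fc sfx; apply: filterS => z /k.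
Qed.

End Circle.

(** * Maps to the circle with the same differential *)

Section ZeroDerivative.
Variable R : realType.

(** The mean value theorem on the segment from [z0] to [z]. *)
Lemma diff0_ball_cst (E : normedModType R) (phi : E -> R^o) (z0 z : E) (e : R) :
  (forall y, ball z0 e y -> is_diff y phi 0) -> ball z0 e z -> phi z = phi z0.
Proof.
move=> dphi z0z.
pose s (t : R^o) : E := z0 + t *: (z - z0).
have bs t : 0 <= t <= 1 -> ball z0 e (s t).
  move=> /andP[t0 t1]; rewrite -ball_normE /= /s opprD addNKr normrN normrZ.
  rewrite ger0_norm //; apply: le_lt_trans (_ : `|z0 - z| < e).
    by rewrite distrC ler_piMl.
  by move: z0z; rewrite -ball_normE.
have ds (t : R^o) : is_diff t s ( *:%R^~ (z - z0)).
  have h : is_diff t (cst z0 + (fun t : R^o => t *: (z - z0)))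
      (0 + *:%R^~ (z - z0)) by exact: is_diffD.
  by rewrite add0r in h.
have dh (t : R^o) : 0 <= t <= 1 -> is_diff t (phi \o s) (0 : R^o -> R^o).
  move=> t01; have dp := dphi _ (bs t t01); have dst := ds t.
  have h := is_diff_comp dst dp; apply: is_diff_fun_eq h _ => v //.
have [|t||c _] := @MVT_segment R (phi \o s) (fun=> 0) 0 1.
- exact: ler01.
- rewrite in_itv /= => /andP[t0 t1].
  have [dt1 dt2] := dh t ltac:(by rewrite !ltW).
  by apply: DeriveDef; [exact: diff_derivable|rewrite deriveE // dt2].
- apply: continuous_in_subspaceT => t; rewrite inE /= in_itv /= => t01.
  by apply: differentiable_continuous; have [] := dh t t01.
- rewrite mul0r /s /= scale1r scale0r addr0 subrKC => /eqP.
  by rewrite subr_eq0 => /eqP.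
Qed.

(** The lifts at different points are unrelated and each is only controlled at its
  own point.  The lift [phi] at [z0] is kept: near any [z] close to [z0] it
  differs from the lift at [z] by a constant integer, because both stay in an
  interval of length 1.  So [phi] itself has zero differential on a ball. *)
Lemma circle_lift0_cst (E : normedModType R) (f : E -> circle R) (z0 : E) :
  (\forall z \near z0, exists2 phi : E -> R^o, is_diff z phi 0 &
     \forall y \near z, circle_pi (phi y) = f y) ->
  \forall z \near z0, f z = f z0.
Proof.
move=> hl; have [phi dphi phif] := nbhs_singleton hl.
have half0 : (0 : R) < 2^-1 by rewrite invr_gt0.
have cphi : {for z0, continuous phi}.
  by apply: differentiable_continuous; have [] := dphi.
have near_phi : \forall z \near z0, `|phi z0 - phi z| < 2^-1.
  by have /cvgr_dist_lt := cphi; apply.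
have : \forall z \near z0,
    [/\ `|phi z0 - phi z| < 2^-1, circle_pi (phi z) = f z &
        exists2 psi : E -> R^o, is_diff z psi 0 &
          \forall y \near z, circle_pi (psi y) = f y].
  by apply: filterS3 near_phi phif hl.
move=> /nbhs_ballP[e /= e0 he].
have dball z : ball z0 e z -> is_diff z phi 0.
  move=> z0z; have [zphi zf [psi dpsi psif]] := he _ z0z.
  have psiz : circle_pi (psi z) = circle_pi (phi z).
    by rewrite zf (nbhs_singleton psif).
  have [k ek] := circle_pi_eq psiz.
  apply: (@near_eq_is_diff _ _ _ (psi - cst (k%:~R : R^o))); last first.
    have h : is_diff z (psi - cst (k%:~R : R^o)) (0 - 0) by exact: is_diffB.
    by rewrite subr0 in h.
  have cpsi : {for z, continuous psi}.
    by apply: differentiable_continuous; have [] := dpsi.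
  have near1 : \forall y \near z, `|phi z0 - (psi y - k%:~R)| < 2^-1.
    have c : {for z, continuous (fun y => psi y - k%:~R)}.
      by apply: continuousB => //; exact: cvg_cst.
    have ez : psi z - k%:~R = phi z by rewrite -ek opprB subrKC.
    have /cvgr_distC_lt h := c.
    rewrite /= ez in h.
    have [d d0 dd] : exists2 d, 0 < d & d + `|phi z0 - phi z| <= 2^-1.
      by exists (2^-1 - `|phi z0 - phi z|); rewrite ?subr_gt0 // subrK.
    apply: filterS (h _ d0) => y yd.
    rewrite -(subrKA (phi z)).
    apply: le_lt_trans (ler_normD _ _) _; rewrite (distrC (phi z)).
    by apply: lt_le_trans dd; rewrite addrC ltrD2r.
  have near2 : \forall y \near z, ball z0 e y.
    by apply: open_nbhs_nbhs; split => //; exact: ball_open.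
  apply: filterS3 near1 near2 psif => y y1 /he[y2 yf _] py /=.
  apply: circle_pi_inj_near.
    rewrite !fctE -[X in `|X|](subrKA (phi z0)).
    apply: le_lt_trans (ler_normD _ _) _.
    by rewrite distrC; lra.
  by rewrite !fctE circle_piB circle_pi_int subr0 py yf.
apply/nbhs_ballP; exists e => // z z0z.
have [_ <- _] := he _ z0z.
by rewrite (diff0_ball_cst dball z0z) (nbhs_singleton phif).
Qed.

(** In a chart, the difference of the local lifts of [f] and [g] has zero
  differential, so [f - g] is locally constant. *)
Lemma circle_diff_cst (E : normedModType R) (M : charted E)
    (f g : M -> circle_charted R) :
  is_manifold M -> connected [set: M] ->
  (forall x, exists2 L, is_tmap f x L & is_tmap g x L) ->
  forall x y, f x - g x = f y - g y.
Proof.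
move=> hM cM fg.
have loc (x : M) : \forall y \near x, f y - g y = f x - g x.
  have ax := manifold_adapted x hM; set c := chart_at x.
  have [[cx sx] tx kx _ _] := ax.
  have [_ charts at_ trans] := hM.
  have [[os ot] hs ht fc bc] := charts _ cx.
  have near_lift : \forall z \near fwd c x, exists2 phi : E -> R^o,
      is_diff z phi 0 & \forall y \near z, circle_pi (phi y) =
                          f (bwd c y) - g (bwd c y).
    apply: filterS tx => z tz; set y := bwd c z.
    have ay := manifold_adapted y hM; have [[cy sy] _ _ _ _] := ay.
    have bt : @is_tmap R _ _ (vec E) M (bwd c) z
        ('d (fwd (chart_at y) \o bwd c) z).
      split; first exact: bc.
      apply: differentiableP; have [+ _] := trans _ _ cx cy 1%N; apply.
      by split => //; exact: nbhs_singleton sy.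
    have [L fL gL] := fg y.
    have az := @vec_adapted R E z.
    have [phi dphi phif] := is_tmap_lift az 
      (@is_tmap_comp R _ _ _ (vec E) M _ (bwd c) f z _ _ az ay bt fL).
    have [psi dpsi psig] := is_tmap_lift az 
      (@is_tmap_comp R _ _ _ (vec E) M _ (bwd c) g z _ _ az ay bt gL).
    exists (phi - psi).
      by have h := is_diffB dphi dpsi; rewrite subrr in h.
    by apply: filterS2 phif psig => v /= <- <-; rewrite -circle_piB.
  have := circle_lift0_cst near_lift; rewrite adapted_bwdK // => h.
  have := fc _ (nbhs_singleton sx) _ h; rewrite /= nbhs_simpl /=.
  by apply: filterS2 sx => y /kx /= ->.
have gen x : [set y | f y - g y = f x - g x] = [set: M].
  apply: cM; first by exists x.
    exists [set y | f y - g y = f x - g x]; last by rewrite setTI.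
    by rewrite openE => y yx; apply: filterS (loc y) => z; rewrite yx.
  exists [set y | f y - g y = f x - g x]; last by rewrite setTI.
  rewrite -[X in closed X]setCK; apply: open_closedC; rewrite openE => y yx.
  by apply: filterS (loc y) => z zy /=; rewrite zy.
by move=> x y; have : [set: M] y by []; rewrite -(gen x) => /= ->.
Qed.

(** The hypothesis says that [p - p 0] is a homomorphism.  So
  [p t - p 0 = n (p (t / n) - p 0)] lifts to [n (phi (t / n) - phi 0)], where
  [phi] is a lift of [p] near 0, and this tends to [t phi'(0)]. *)
Lemma circle_affine_line (p : line R -> circle_charted R) (L : R^o -> R^o) :
  (forall s t : R, (p (s + t) : circle R) + p 0 = (p s : circle R) + p t) ->
  is_tmap p (0 : R) L ->
  forall t : R, p t = (p 0 : circle R) + circle_pi (t * L 1 : R).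
Proof.
move=> pD pL t.
have pn (s : R) n : (p (s *+ n) : circle R) = p 0 + (p s - p 0 : circle R) *+ n.
  elim: n => [|n IH]; first by rewrite !mulr0n addr0.
  apply: (@addIr _ (p 0 : circle R)); rewrite mulrS pD IH mulrS.
  rewrite -[X in X + _](subrK (p 0 : circle R)).
  rewrite (addrC (p 0 : circle R) (_ *+ n)).
  by rewrite addrACA addrA (addrC (p 0 : circle R) (_ + _)).
have [phi dphi phip] := is_tmap_lift (@vec_adapted R R^o 0) pL.
rewrite /= in dphi phip.
have [dphi1 dphi2] := dphi.
have -> : t * L 1 = L t.
  by rewrite -dphi2 -[in RHS](mulr1 t) -[t * 1]/(t *: (1 : R^o)) linearZ.
have phi0 : circle_pi (phi 0) = p 0 := nbhs_singleton phip.
have dt : (h^-1 *: ((phi \o shift 0) (h *: t) - phi 0) @[h --> (0:R)^'])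
    --> (L t : R^o).
  have := @diff_derivable R R^o R^o phi 0 t dphi1.
  by rewrite -dphi2 -deriveE.
suff : p t - p 0 - circle_pi (L t) = 0 :> circle R.
  by move/eqP; rewrite subr_eq add0r subr_eq addrC => /eqP.
apply: circle_small_eq0 => e e0.
have /cvgr_distC_lt /(_ e e0) near1 := dt.
have near2 : \forall h \near (0:R)^', circle_pi (phi (h *: t)) = p (h *: t).
  apply: nbhs_dnbhs.
  have c : {for (0 : R^o), continuous (fun h : R^o => h *: (t : R^o))}.
    exact: scalel_continuous.
  have := c (fun z => circle_pi (phi z) = p z).
  by rewrite /= scale0r => /(_ phip).
have [d /= d0 hd] : nbhs (0:R)^' (fun h : R =>
    `|h^-1 *: ((phi \o shift 0) (h *: t) - phi 0) - L t| < e /\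
    circle_pi (phi (h *: t)) = p (h *: t)).
  by apply: filterS2 near1 near2.
pose n := (Num.truncn d^-1).+1.
have n0 : (0 : R) < n%:R by rewrite ltr0n.
have nd : n%:R^-1 < d.
  by rewrite -[d]invrK ltf_pV2 ?posrE ?invr_gt0 // truncnS_gt.
have [] := hd n%:R^-1.
- by rewrite /= sub0r normrN ger0_norm ?invr_ge0 ?ltW.
- by rewrite invr_eq0 gt_eqF.
rewrite invrK /= addr0 => he hp.
exists (n%:R *: (phi (n%:R^-1 *: t) - phi 0) - L t) => //.
have tn : t = (n%:R^-1 *: (t : R^o)) *+ n.
  by rewrite -scaler_nat scalerA divff ?gt_eqF // scale1r.
rewrite scaler_nat circle_piB circle_piMn circle_piB hp phi0 {3}tn pn.
by rewrite [_ + _ *+ _]addrC addrK.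
Qed.

End ZeroDerivative.

(** * One-parameter subgroups of the circle and of the torus *)

Section Exponential.
Variable R : realType.

Lemma C_on_cst (E F : normedModType R) k (U : set E) (b : F) :
  C_on k U (fun=> b).
Proof.
elim: k b => [|k IH] b /=; first by move=> x _; exact: cvg_cst.
split=> [x _|v]; first exact: differentiable_cst.
rewrite (_ : (fun x => 'D_v (fun=> b) x) = fun=> 0) //.
by apply/funext => x; exact: derive_cst.
Qed.

Lemma is_diff_affine (F : normedModType R) (v b : F) (t : R^o) :
  is_diff t (fun t : R^o => t *: v + b) ( *:%R^~ v).
Proof.
have h : is_diff t ( *:%R^~ v + cst b) ( *:%R^~ v + 0) by exact: is_diffD.
by rewrite addr0 in h.
Qed.

Lemma C_on_affine (F : normedModType R) k (U : set R^o) (v b : F) :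
  C_on k U (fun t : R^o => t *: v + b).
Proof.
have d t := is_diff_affine v b t.
case: k => [|k] /=.
  by move=> t _; apply: differentiable_continuous; have [] := d t.
split=> [t _|u]; first by have [] := d t.
rewrite (_ : (fun t => 'D_u _ t) = fun=> u *: v); first exact: C_on_cst.
by apply/funext => t; have [d1 d2] := d t; rewrite deriveE // d2.
Qed.

(** Near each point [f] may agree with a different [g]: a chart of the circle
  turns a one-parameter subgroup into affine maps that differ from one interval
  to the next. *)
Lemma C_on_local (E F : normedModType R) k (U : set E) (f : E -> F) :
  (forall x, U x -> exists2 g, C_on k setT g & \forall y \near x, f y = g y) ->
  C_on k U f.
Proof.
elim: k f => [|k IH] f h /=.
  move=> x /h[g gc fg]; have fgx : f x = g x := nbhs_singleton fg.
  rewrite /prop_for /continuous_at fgx; apply: cvg_trans (gc x I).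
  by apply: near_eq_cvg; apply: filterS fg => y ->.
split=> [x /h[g [gd _] fg]|v].
  have gf : \forall y \near x, g y = f y by apply: filterS fg => y ->.
  by have [] := near_eq_is_diff gf (differentiableP (gd x I)).
apply: IH => x /h[g [_ gd] fg]; exists (fun y => 'D_v g y); first exact: gd.
have := nbhs_interior fg; apply: filterS => y; exact: near_eq_derive.
Qed.

Lemma smooth_line (F : normedModType R) (N : charted F) (f : line R -> N) :
  continuous (f : R^o -> N) ->
  (forall d t, atlas N d -> source d (f t) -> exists v b : F,
    \forall s \near (t : R^o), fwd d (f s) = s *: v + b) ->
  smooth f.
Proof.
move=> fc h; split=> [x _|c d -> Nd k]; first exact: fc.
apply: C_on_local => t [_ [_ /= dt]]; have [v [b e]] := h d t Nd dt.
by exists (fun s : R^o => s *: v + b); first exact: C_on_affine.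
Qed.

Lemma is_tmap_circle_line (v : R) (t : line R) :
  @is_tmap R _ _ (line R) (circle_charted R)
    (fun s : R => circle_pi (s * v)) t (fun s => s * v).
Proof.
have h : @is_tmap R R^o R^o (line R) (line R)
    (fun s : R => s * v) t (fun s => s * v).
  by apply: is_tmap_vec; exact: (is_diff_scalel (v : R^o)).
exact: (is_tmap_comp (@vec_adapted R R^o t) (@vec_adapted R R^o _) h
  (is_tmap_circle_pi _)).
Qed.

Lemma circle_line_chart (v a t : R) :
  source (circle_chart a) (circle_pi (t * v)) ->
  exists b, \forall s \near (t : R^o),
    fwd (circle_chart a) (circle_pi (s * v)) = s *: (v : R^o) + b.
Proof.
move=> h; exists (fwd (circle_chart a) (circle_pi (t * v)) - t * v).
have c : {for (t : R^o), continuous (fun s : R^o => s *: (v : R^o))}.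
  exact: scalel_continuous.
exact: c (circle_chart_near h).
Qed.

Definition torus_exp (r : nat) (v : 'rV[R]_r) : torus_lie R r :=
  \row_i circle_pi (v 0 i).

Lemma torus_expD r (u v : 'rV[R]_r) :
  torus_exp (u + v) = (torus_exp u : 'rV[circle R]_r) + torus_exp v.
Proof. by apply/rowP => i; rewrite !mxE circle_piD. Qed.

Lemma torus_exp0 r : torus_exp (0 : 'rV[R]_r) = (0 : 'rV[circle R]_r).
Proof. by apply/rowP => i; rewrite !mxE circle_pi0. Qed.

Lemma torus_line_chart r (c : 'I_r -> chart R^o (circle R)) (v : 'rV[R]_r)
    (t : R) :
  (forall i, range (@circle_chart R) (c i)) ->
  source (pow_chart c) (torus_exp (t *: v)) ->
  exists b, \forall s \near (t : R^o),
    fwd (pow_chart c) (torus_exp ((s : R) *: v)) = s *: v + b.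
Proof.
move=> hc ht.
have h i : exists b, \forall s \near (t : R^o),
    fwd (c i) (circle_pi (s * v 0 i)) = s *: (v 0 i : R^o) + b.
  have [a _ ca] := hc i; have := ht i; rewrite -ca !mxE.
  exact: circle_line_chart.
have [b hb] := choice h; exists (\row_i b i).
have : \forall s \near (t : R^o), forall i,
    fwd (c i) (circle_pi (s * v 0 i)) = s *: (v 0 i : R^o) + b i.
  exact: (@filter_forall _ _ _ (nbhs (t : R^o)) _ hb).
by apply: filterS => x e; apply/rowP => i; rewrite !mxE; exact: e.
Qed.

Lemma is_tmap_torus_line r (v : 'rV[R]_r) (t : line R) :
  is_tmap (fun s : line R => torus_exp ((s : R) *: v)) t (fun s => s *: v).
Proof.
apply: (@is_tmap_eq _ _ _ _ _ _ _ (fun s : R^o => \row_i (s * v 0 i))); last first.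
  by move=> s; apply/rowP => i; rewrite !mxE.
apply: is_tmap_row => i.
rewrite (_ : (fun y => _) = (fun s : R => circle_pi (s * v 0 i))).
  exact: is_tmap_circle_line.
by apply/funext => s; rewrite !mxE.
Qed.

(** The line [t |-> t v mod 1] is a one-parameter subgroup with velocity [v], and
  by [circle_affine_line] there is no other. *)
Lemma lexp_circle (v : R^o) : lexp (circle_lie R) v = circle_pi (v : R).
Proof.
apply: xget_unique.
  exists (fun t : R => circle_pi (t * v)); split.
  - apply: smooth_line => [t|_ t [a _ <-] s].
      by have [] := is_tmap_circle_line v t.
    by have [b e] := circle_line_chart s; exists v, b.
  - by move=> s t; rewrite mulrDl circle_piD.
  - by rewrite /velocity (tmapE (is_tmap_circle_line v 0)) mul1r.
  - by rewrite mul1r.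
move=> g [gamma [sg gD gv <-]].
have g0 : gamma 0 = 0 :> circle R.
  by apply: (@addIr _ (gamma 0 : circle R)); rewrite add0r -[LHS]gD addr0.
have tg := smooth_is_tmap sg (@vec_adapted R R^o 0) (circle_adapted _).
have gA (s t : R) : (gamma (s + t) : circle R) + gamma 0 =
    (gamma s : circle R) + gamma t by rewrite g0 addr0; exact: gD.
by rewrite (circle_affine_line gA tg) g0 add0r mul1r -/(velocity gamma 0) gv.
Qed.

Lemma lexp_torus r (v : 'rV[R]_r) : lexp (torus_lie R r) v = torus_exp v.
Proof.
apply: xget_unique.
  exists (fun t : line R => torus_exp ((t : R) *: v)); split.
  - apply: smooth_line => [t|_ t [c hc ->] /= s].
      by have [] := is_tmap_torus_line v t.
    by have [b e] := torus_line_chart hc s; exists v, b.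
  - by move=> s t; rewrite scalerDl torus_expD.
  - by rewrite /velocity (tmapE (is_tmap_torus_line v 0)) scale1r.
  - by rewrite scale1r.
move=> g [gamma [sg gD gv <-]]; apply/rowP => i.
have ta : adapted (gamma 0) by apply: pow_adapted => k; exact: circle_adapted.
have tg := is_tmap_entry i (smooth_is_tmap sg (@vec_adapted R R^o 0) ta).
have gD' (s t : R) : (gamma (s + t) 0 i : circle R) = gamma s 0 i + gamma t 0 i.
  by rewrite gD mxE.
have g0 : (gamma 0 0 i : circle R) = 0.
  by apply: (@addIr _ (gamma 0 0 i : circle R)); rewrite add0r -gD' addr0.
have gA (s t : R) : (gamma (s + t) 0 i : circle R) + gamma 0 0 i =
    (gamma s 0 i : circle R) + gamma t 0 i by rewrite g0 addr0 gD'.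
rewrite (circle_affine_line gA tg) g0 add0r mul1r -/(velocity gamma 0) gv.
by rewrite mxE.
Qed.

Lemma circle_factor_pi r (j : 'I_r) (y : R) :
  circle_factor j (circle_pi y) = torus_exp (y *: delta_mx 0 j).
Proof.
apply/rowP => i; rewrite !mxE eqxx /=; case: eqP => _.
  by rewrite mulr1.
by rewrite mulr0 circle_pi0.
Qed.

(** If [u] were 0, the exponential map of the circle would be injective, but it
  sends 1 to the unit. *)
Lemma circle_generatorP r (j : 'I_r) (eta : 'rV[R]_r) :
  circle_generator j eta -> exists2 u : R, u != 0 & eta = u *: delta_mx 0 j.
Proof.
move=> [u hu ->]; exists u.
  apply/eqP => u0; have [/(_ _)] := hu 1.
  rewrite lexp_circle (circle_pi_int R 1) => -[//|z] /eqP.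
  by rewrite u0 mul0rz oner_eq0.
have h : is_tmap (@circle_factor R r j) (lone (circle_lie R))
    (fun v => \row_i (if i == j then v else 0)).
  apply: is_tmap_row => i.
  rewrite (_ : (fun y => _) =
      (fun y : circle R => if i == j then y else 0)); last first.
    by apply/funext => y; rewrite mxE.
  case: (i == j); last exact: is_tmap_cst.
  by apply: is_tmap_id; exact: circle_adapted.
rewrite (tmapE h); apply/rowP => i; rewrite !mxE eqxx /=.
by case: eqP => _; rewrite ?mulr1 ?mulr0.
Qed.

End Exponential.

(** * McDuff maps along torus orbits *)

Section TorusAction.
Variables (R : realType) (m r : nat) (E : normedModType R) (M : charted E).
Variables (C : lie_data 'rV[R]_m) (act : prod_lie C (torus_lie R r) -> M -> M).
Hypotheses (hM : is_manifold M) (hC : is_lie_group C).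
Hypothesis hact : is_smooth_action act.

Lemma act_r0 x : act_r act (0 : 'rV[circle R]_r) x = x.
Proof. by have [h _ _] := hact; exact: h. Qed.

Lemma act_rD (s t : 'rV[circle R]_r) x :
  act_r act (s + t) x = act_r act s (act_r act t x).
Proof.
have [_ h _] := hact; rewrite /act_r -h /=.
by have [_ [_ -> _] _ _] := hC.
Qed.

Lemma act_rC (s t : 'rV[circle R]_r) x :
  act_r act s (act_r act t x) = act_r act t (act_r act s x).
Proof. by rewrite -!act_rD addrC. Qed.

(** Covers both partial maps of the action: [f] constant gives [act_r t], and [g]
  constant gives the orbit curves. *)
Lemma is_tmap_act_r_comp (F : normedModType R) (N : charted F)
    (f : N -> torus_lie R r) (g : N -> M) (y : N) (L : F -> 'rV[R]_r)
    (L' : F -> E) :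
  adapted y -> is_tmap f y L -> is_tmap g y L' ->
  exists K, is_tmap (fun z => act_r act (f z) (g z)) y K.
Proof.
move=> ay fL gL; have [_ _ sact] := hact.
have a1 : adapted (lone C) by apply: manifold_adapted; have [] := hC.
have af : adapted (f y) by apply: pow_adapted => i; exact: circle_adapted.
have ap := prod_adapted (prod_adapted a1 af) (manifold_adapted (g y) hM).
have ta := smooth_is_tmap sact ap (manifold_adapted _ hM).
have tp := is_tmap_pair (is_tmap_pair (is_tmap_cst (lone C) y) fL) gL.
have := is_tmap_comp ay ap tp ta.
by move=> h; eexists; exact: h.
Qed.

Lemma is_tmap_act_r (t : torus_lie R r) (x : M) :
  is_tmap (act_r act t) x (tmap (act_r act t) x).
Proof.
have ax := manifold_adapted x hM.
have [K hK] := is_tmap_act_r_comp ax (is_tmap_cst t x) (is_tmap_id ax).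
by rewrite (tmapE hK).
Qed.

Definition orbit_line (v : 'rV[R]_r) (x : M) (t : line R) : M :=
  act_r act (torus_exp ((t : R) *: v)) x.

Lemma is_tmap_orbit_line (v : 'rV[R]_r) (x : M) (t : line R) :
  is_tmap (orbit_line v x) t (tmap (orbit_line v x) t).
Proof.
have [K hK] := is_tmap_act_r_comp (@vec_adapted R R^o t) (is_tmap_torus_line v t)
  (is_tmap_cst x (t : line R)).
by rewrite (tmapE hK).
Qed.

Lemma orbit_line0 (v : 'rV[R]_r) (x : M) : orbit_line v x (0 : R) = x.
Proof. by rewrite /orbit_line scale0r torus_exp0 act_r0. Qed.

Lemma fundamentalE (v : 'rV[R]_r) (x : M) :
  fundamental (act_r act) v x = velocity (orbit_line (- v) x) 0.
Proof.
rewrite /fundamental; congr (velocity _ 0); apply/funext => t.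
by rewrite lexp_torus scaleNr -scalerN.
Qed.

(** Fundamental fields are invariant because the torus is abelian: [act_r s]
  carries the orbit curve through [x] to the one through [s.x]. *)
Lemma fundamental_act_r (v : 'rV[R]_r) (s : 'rV[circle R]_r) (x : M) :
  fundamental (act_r act) v (act_r act s x) =
  tmap (act_r act s) x (fundamental (act_r act) v x).
Proof.
rewrite !fundamentalE /velocity.
have a0 := @vec_adapted R R^o 0.
have := is_tmap_comp a0 (manifold_adapted _ hM)
  (is_tmap_orbit_line (- v) x (0 : R)) (is_tmap_act_r s _).
have -> : act_r act s \o orbit_line (- v) x = orbit_line (- v) (act_r act s x).
  by apply/funext => t; exact: act_rC.
by move/tmapE ->; rewrite orbit_line0.
Qed.

(** The form [i_X w] is invariant under the torus, so [f \o act_r s] has the same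
  differential as [f]. *)
Lemma mcduff_act_r_cst (w : twoform M) (eta : 'rV[R]_r)
    (f : M -> circle_charted R) (s : 'rV[circle R]_r) (x y : M) :
  connected [set: M] -> invariant_form act w -> is_mcduff_map act w eta f ->
  (f (act_r act s x) : circle R) - f x = f (act_r act s y) - f y.
Proof.
move=> cM inv [sf df]; have tf z : is_tmap f z (tmap f z).
  exact: smooth_is_tmap sf (manifold_adapted _ hM) (circle_adapted _).
apply: (@circle_diff_cst _ _ _ (f \o act_r act s) f) => // z.
exists (tmap f z) => //.
have := is_tmap_comp (manifold_adapted z hM) (manifold_adapted _ hM)
  (is_tmap_act_r s z) (tf _).
move=> /is_tmap_eq; apply => u /=.
have df' y' v : tmap f y' v = w y' (fundamental (act_r act) eta y') v := df y' v.
by rewrite !df' fundamental_act_r; exact: (inv (lone C, s) z).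
Qed.

(** Along an orbit curve, [f] increases by a homomorphism from the line to the
  circle, by the previous lemma; its slope is the derivative at time 0. *)
Lemma mcduff_orbit_line (w : twoform M) (eta v : 'rV[R]_r)
    (f : M -> circle_charted R) (x : M) (t : R) :
  connected [set: M] -> invariant_form act w -> is_mcduff_map act w eta f ->
  f (orbit_line v x t) = (f x : circle R) +
    circle_pi (t * w x (fundamental (act_r act) eta x)
                       (velocity (orbit_line v x) 0)).
Proof.
move=> cM inv hf; have [sf df] := hf.
have tf z : is_tmap f z (tmap f z).
  exact: smooth_is_tmap sf (manifold_adapted _ hM) (circle_adapted _).
have tp := is_tmap_comp (@vec_adapted R R^o 0) (manifold_adapted _ hM)
  (is_tmap_orbit_line v x (0 : R)) (tf _).
have pD (s s' : R) : ((f \o orbit_line v x) (s + s') : circle R) +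
    (f \o orbit_line v x) 0 =
    ((f \o orbit_line v x) s : circle R) + (f \o orbit_line v x) s'.
  rewrite /= orbit_line0 /orbit_line scalerDl torus_expD act_rD.
  have /eqP := mcduff_act_r_cst (torus_exp (s *: v))
    (act_r act (torus_exp (s' *: v)) x) x cM inv hf.
  by rewrite subr_eq addrAC => /eqP ->; rewrite subrK.
have := circle_affine_line pD tp t; rewrite /= orbit_line0 => ->.
congr (_ + circle_pi (t * _)); exact: df.
Qed.

End TorusAction.

Lemma torus_sum_factors (R : realType) (r : nat) (t : 'rV[circle R]_r) :
  t = \sum_j (circle_factor j (t 0 j) : 'rV[circle R]_r).
Proof.
apply/rowP => i; rewrite summxE (bigD1 i) //= big1 => [|j ji].
  by rewrite !mxE eqxx addr0.
by rewrite !mxE eq_sym (negbTE ji).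
Qed.

Theorem proposition3p3 (R : realType) (n m r : nat)
  (M : charted 'rV[R]_n) (w : twoform M)
  (C : lie_data 'rV[R]_m) (act : prod_lie C (torus_lie R r) -> M -> M)
  (mu1 : M -> 'cV[R]_m) (mu2 : M -> 'rV[circle R]_r)
  (hM : is_manifold M) (hMcpt : compact [set: M]) (hMconn : connected [set: M])
  (hw : symplectic w)
  (hC : is_lie_group C) (hCcpt : compact [set: C]) (hCconn : connected [set: C])
  (hact : is_smooth_action act) (hinv : invariant_form act w)
  (hham : hamiltonian (act_l act) w)
  (hnonham : totally_nonhamiltonian (act_r act) w)
  (hmu : generalized_moment_map act w mu1 mu2) :
  exists Z : 'M[int]_r,
    (forall i, Z i i = 0) /\
    forall (t : 'rV[circle R]_r) (x : M),
      mu2 (act_r act t x) = Aff Z t (mu2 x).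
Proof.
have [w' [eta [[sw' inv' _] _ geta _ hmc]]] := hmu.
have [[x0 _]|noM] := pselect (exists x : M, True); last first.
  by exists 0; split=> [i|t x]; [rewrite mxE|case: noM; exists x].
pose c i (s : 'rV[circle R]_r) : circle R :=
  mu2 (act_r act s x0) 0 i - mu2 x0 0 i.
have cE i s x : mu2 (act_r act s x) 0 i = c i s + mu2 x 0 i.
  apply/eqP; rewrite -subr_eq; apply/eqP.
  exact: (mcduff_act_r_cst hM hC hact s x x0 hMconn inv' (hmc i)).
have cD i : {morph c i : s t / s + t}.
  by move=> s t; rewrite {1}/c (act_rD hC hact) cE -addrA.
have c0 i : c i 0 = 0 by rewrite /c (act_r0 hact) subrr.
have c_line i v t : c i (torus_exp (t *: v)) =
    circle_pi (t * w' x0 (fundamental (act_r act) (eta i) x0)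
                         (velocity (orbit_line act v x0) 0)).
  apply/eqP; rewrite subr_eq addrC; apply/eqP.
  exact: (mcduff_orbit_line hM hC hact v x0 t hMconn inv' (hmc i)).
have c_factor i j : exists z : int, (i = j -> z = 0) /\
    forall s : circle R, c i (circle_factor j s) = s *~ z.
  have [<-|ij] := eqVneq i j.
    exists 0; split=> // s; rewrite mulr0z -(circle_pi_repr s) circle_factor_pi.
    (* The [i]-th circle is the image of the line through [eta i], along which
       the slope is a multiple of [w' (X, X)]. *)
    have [u u0 etaE] := circle_generatorP (geta i).
    have -> : repr s *: delta_mx 0 i = (- (repr s / u)) *: (- eta i).
      by rewrite scalerN scaleNr opprK etaE scalerA divfK.
    rewrite c_line -(fundamentalE act).
    by have [[_ _ -> _] _ _] := sw'; rewrite mulr0 circle_pi0.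
  (* The slope along the [j]-th circle is an integer: time 1 is a full turn. *)
  have [z az] : exists z : int, w' x0 (fundamental (act_r act) (eta i) x0)
      (velocity (orbit_line act (delta_mx 0 j) x0) 0) - 0 = z%:~R.
    apply: circle_pi_eq; rewrite -[X in circle_pi X]mul1r -c_line.
    rewrite -circle_factor_pi (circle_pi_int R 1) circle_pi0 -[RHS](c0 i).
    by congr c; apply/rowP => k; rewrite !mxE; case: eqP.
  exists z; split=> [/eqP|s]; first by rewrite (negbTE ij).
  rewrite subr0 in az.
  by rewrite -(circle_pi_repr s) circle_factor_pi c_line az -circle_piMz mulrzr.
have [Z hZ] := choice (fun p : 'I_r * 'I_r => c_factor p.1 p.2).
exists (\matrix_(i, j) Z (i, j)); split=> [i|t x].
  by rewrite mxE; apply: (hZ (i, i)).1.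
apply/rowP => i; rewrite cE !mxE {1}(torus_sum_factors t).
rewrite (big_morph (c i) (cD i) (c0 i)); congr (_ + _).
by apply: eq_bigr => j _; rewrite mxE; exact: (hZ (i, j)).2.
Qed.
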